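(* Let $\mu$ be a finite Borel measure on $(-\pi,\pi)$ and $\mu^\#$ its symmetrization. Then \[u_{\mu^\#}(0)=\max_{[-\pi,\pi]}u_{\mu^\#}\ge\max_{[-\pi,\pi]}u_\mu,\] with equality if and only if $\mu=\mu^\#$.
   Context: A ''Borel measure on $(-\pi,\pi)$'' means a positive, non-zero measure on the Borel sets of $(-\pi,\pi)$; $\lambda$ is Lebesgue measure. $G(x,y)=-\frac{xy}{2\pi}-\frac12|x-y|+\frac{\pi}{2}$ on $[-\pi,\pi]^2$, and $u_\mu(x)=\int_{-\pi}^{\pi}G(x,y)\,d\mu(y)$ (the unique absolutely continuous solution of $-u''=\mu$ in distributions on $(-\pi,\pi)$ with $u(\pm\pi)=0$). Every finite Borel measure decomposes uniquely as $\mu=\nu+\sigma+\delta$ with $d\nu=f\,d\lambda$, $0\le f\in L^1[-\pi,\pi]$, $\sigma\perp\lambda$ atomless, $\delta$ purely discontinuous (a countable sum of nonnegative point masses). Symmetric decreasing rearrangement: $f^*(t)=\inf\{s:\lambda(\{f>s\})\le t\}$ for $t\in(0,2\pi)$ (with $f^*(0)=\operatorname{ess\,sup} f$, $f^*(2\pi)=\operatorname{ess\,inf}f$) and $f^\#(t)=f^*(2|t|)$ on $[-\pi,\pi]$. Symmetrization: $d\mu^\#=f^\#\,d\lambda+M\,d\delta_0$ with $M=\sigma((-\pi,\pi))+\delta((-\pi,\pi))$. *)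

(* Defs.v *)
From HB Require Import structures.
From mathcomp Require Import all_boot all_order all_algebra.
From mathcomp Require Import all_classical all_reals all_analysis ess_sup_inf.
Set Implicit Arguments. Unset Strict Implicit. Unset Printing Implicit Defensive.
Import Order.TTheory GRing.Theory Num.Theory.
Import numFieldNormedType.Exports.
Local Open Scope classical_set_scope.
Local Open Scope ring_scope.

Section defs.
Variable R : realType.

Definition Icl : set R := `[- pi, pi].
Definition Iop : set R := `]- pi, pi[.

Definition leb_pipi :=
  mrestr (@lebesgue_measure R) (measurable_itv `[- pi, pi]%R).

Definition green (x y : R) : R := - (x * y) / (2 * pi) - `|x - y| / 2 + pi / 2.

Definition upot (mu : {measure set R -> \bar R}) (x : R) : \bar R :=
  (\int[mu]_(y in Icl) (green x y)%:E)%E.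

Definition fstar (f : R -> R) (t : R) : \bar R :=
  if t == 0 then ess_sup leb_pipi (fun x => (f x)%:E)
  else if t == 2 * pi then ess_inf leb_pipi (fun x => (f x)%:E)
  else ereal_inf [set s%:E | s in
         [set s : R | (leb_pipi [set x | (s < f x)%R] <= t%:E)%E]].

(* symmetric decreasing rearrangement f^#(t) = f^*(2|t|) on [-pi,pi]
   (set to 0 outside [-pi,pi], where it is never used) *)
Definition fsharp (f : R -> R) (t : R) : \bar R :=
  if `|t| <= pi then fstar f (2 * `|t|) else 0%E.

Definition singular_leb (sigma : {measure set R -> \bar R}) : Prop :=
  exists N : set R, [/\ measurable N, lebesgue_measure N = 0%E & sigma (~` N) = 0%E].

Definition atomless (sigma : {measure set R -> \bar R}) : Prop :=
  forall x : R, sigma [set x] = 0%E.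

Definition purely_discontinuous (delta : {measure set R -> \bar R}) : Prop :=
  exists (a : nat -> R) (c : nat -> R), (forall n, 0 <= c n) /\
    forall A, measurable A ->
      delta A = (\sum_(0 <= n <oo) (c n)%:E * \d_(a n) A)%E.

End defs.

(* Main.v *)
(* Write h_x := G(x, .) / (1 - x^2 / pi^2).  The superlevel set {h_x > s} is an
   interval of length 2 (pi - 2 s) for every x, and for x = 0 it is the centred
   interval ]-(pi - 2 s), pi - 2 s[.  A set of length at most 2 r carries at most
   the mass mu^#(]-r, r[), for mu as well as for mu^#: for the density this
   follows from the layer cake formula in the values of f, because f^# is
   equimeasurable with f and its superlevel sets are centred; the singular part
   of mu^# sits at 0.  The layer cake formula in the values of h_x then gives
   u(x) <= (1 - x^2 / pi^2) u_{mu^#}(0) for both potentials.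
   In the equality case the factor forces the maximum to be at 0, and all the
   inequalities under the layer cake integrals are equalities for a dense set of
   levels; hence f = f^# almost everywhere and the singular part is concentrated
   at 0. *)
Require Import Defs.
From HB Require Import structures.
From mathcomp Require Import all_boot all_order all_algebra.
From mathcomp Require Import ring lra.
From mathcomp Require Import all_classical all_reals all_analysis ess_sup_inf.
From mathcomp Require Import measurable_realfun.
Set Implicit Arguments. Unset Strict Implicit. Unset Printing Implicit Defensive.
Import Order.TTheory GRing.Theory Num.Theory.
Import numFieldNormedType.Exports.
Local Open Scope classical_set_scope.
Local Open Scope ring_scope.

(** * Layer cake formula *)

Section layer_cake.
Context d (T : measurableType d) (R : realType).
Implicit Types (D : set T) (g : T -> \bar R).

(** The region between 0 and the graph of [g] on [D]. Its section over a point has length [g], and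
    its section at height [s] is the superlevel set of [g]. The condition [0 <= z.2] cuts off the
    negative heights, which would otherwise give infinite length. *)
Let hypograph D g : set (T * R) :=
  [set z | 0 <= z.2 /\ (z.2%:E < (g \_ D) z.1)%E].

Let measurable_hypograph D g : measurable D -> measurable_fun D g ->
  measurable (hypograph D g).
Proof.
move=> mD mg.
have mg' : measurable_fun setT (g \_ D) by exact/(measurable_restrictT _ _).1.
rewrite (_ : hypograph D g = [set z : T * R | ((z.2)%:E < (g \_ D) z.1)%E]
    `&` (setT `*` `[0, +oo[)); last first.
  apply/seteqP; split => -[x s]; rewrite /hypograph /= in_itv/= andbT.
    by case.
  by case=> ? [].
apply: measurableI; last by apply: measurableX.
rewrite -[X in measurable X]setTI; apply: measurable_lte => //.
  by apply/measurable_EFinP; exact: measurable_snd.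
by apply: measurableT_comp => //; exact: measurable_fst.
Qed.

Let xsection_hypographE D g x : (forall x, D x -> 0 <= g x)%E ->
  lebesgue_measure (xsection (hypograph D g) x) = (g \_ D) x.
Proof.
move=> g0.
have : (0 <= (g \_ D) x)%E by apply: erestrict_ge0.
rewrite (_ : xsection _ _ = [set s | 0 <= s /\ (s%:E < (g \_ D) x)%E]); last first.
  by rewrite /xsection; apply/seteqP; split => s /=; rewrite inE.
case: ((g \_ D) x) => [r| |] // r0.
- rewrite (_ : [set _ | _] = `[0, r[%classic); last first.
    apply/seteqP; split => s /=; rewrite in_itv/= lte_fin.
      by case=> -> ->.
    by case/andP.
  rewrite lebesgue_measure_itv/= lte_fin; rewrite lee_fin in r0.
  by case: ltgtP r0 => // [_|<-] _; rewrite ?oppr0 ?adde0 // oppe0 adde0.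
- rewrite (_ : [set _ | _] = `[0, +oo[%classic).
    by rewrite lebesgue_measure_itv/= ltry.
  apply/seteqP; split => s /=; rewrite in_itv/= ltry andbT; first by case.
  by [].
Qed.

Let ysection_hypographE D g s : 0 <= s ->
  ysection (hypograph D g) s = D `&` [set x | (s%:E < g x)%E].
Proof.
move=> s0; rewrite /ysection; apply/seteqP; split => x /=; rewrite inE /hypograph/=.
  rewrite patchE; case: ifPn => [|_ []]; first by rewrite inE => ? [].
  by rewrite lte_fin => _ /(le_lt_trans s0); rewrite ltxx.
by move=> [Dx sg]; split=> //; rewrite patchE mem_set.
Qed.

Lemma measurable_distribution (m : {sigma_finite_measure set T -> \bar R}) D g :
  measurable D -> measurable_fun D g ->
  measurable_fun `[(0 : R)%R, +oo[ (fun s : R => m (D `&` [set x | (s%:E < g x)%E])).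
Proof.
move=> mD mg.
apply: (eq_measurable_fun (m \o ysection (hypograph D g))).
  move=> s; rewrite inE/= in_itv/= andbT => s0.
  by rewrite ysection_hypographE.
apply: measurable_funTS; apply: measurable_fun_ysection.
exact: measurable_hypograph.
Qed.

(** Tonelli's theorem for the hypograph: its product measure is computed once by vertical and once
    by horizontal sections. The two iterated measures coincide because they agree on rectangles. *)
Lemma layer_cake (m : {sigma_finite_measure set T -> \bar R}) D g :
  measurable D -> measurable_fun D g -> (forall x, D x -> 0 <= g x)%E ->
  (\int[m]_(x in D) g x =
   \int[lebesgue_measure]_(s in `[(0 : R)%R, +oo[) m (D `&` [set x | s%:E < g x]))%E.
Proof.
move=> mD mg g0.
have mA := measurable_hypograph mD mg.
transitivity ((m \x (@lebesgue_measure R))%E (hypograph D g)).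
  rewrite integral_mkcond /product_measure1; apply: eq_integral => x _ /=.
  by rewrite xsection_hypographE.
rewrite (@product_measure_unique _ _ _ _ _ m lebesgue_measure
  (m \x^ (@lebesgue_measure R))%E) //=; last first.
  by move=> A B ? ?; rewrite product_measure2E.
rewrite /product_measure2 [RHS]integral_mkcond; apply: eq_integral => s _ /=.
rewrite patchE; case: ifPn => [|/negP]; rewrite inE/= in_itv/= andbT.
  by move=> s0; rewrite ysection_hypographE.
move=> s0; rewrite (_ : ysection _ _ = set0) ?measure0//.
by rewrite /ysection; apply/seteqP; split => x //=; rewrite inE => -[].
Qed.

End layer_cake.

(** * Layer cake formula for a measure known to be finite only by hypothesis *)

Section finite_layer_cake.
Context d (T : measurableType d) (R : realType).
Variable m : {measure set T -> \bar R}.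
Hypothesis m_fin : (m setT < +oo)%E.

Lemma finite_measurable_distribution D (g : T -> \bar R) :
  measurable D -> measurable_fun D g ->
  measurable_fun `[(0 : R)%R, +oo[ (fun s : R => m (D `&` [set x | (s%:E < g x)%E])).
Proof.
move=> mD mg.
(* The restriction of [m] to the whole space has the same values as [m] and carries the structure of
   a finite, hence sigma-finite, measure. *)
have := measurable_distribution (mfrestr measurableT m_fin) mD mg.
by apply: eq_measurable_fun => s _; rewrite /= /mfrestr /mrestr/= setIT.
Qed.

Lemma finite_layer_cake D (g : T -> \bar R) :
  measurable D -> measurable_fun D g -> (forall x, D x -> 0 <= g x)%E ->
  (\int[m]_(x in D) g x =
   \int[lebesgue_measure]_(s in `[(0 : R)%R, +oo[) m (D `&` [set x | s%:E < g x]))%E.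
Proof.
move=> mD mg g0.
rewrite (eq_measure_integral (mfrestr measurableT m_fin)); last first.
  by move=> A _ _; rewrite /= /mfrestr /mrestr/= setIT.
rewrite layer_cake//; apply: eq_integral => s _.
by rewrite /= /mfrestr /mrestr/= setIT.
Qed.

End finite_layer_cake.

(** The difference [A - B] is nonnegative with integral at most 0, so it vanishes almost everywhere,
    and an interval of positive length cannot avoid the points of equality. This turns an equality
    of layer cake integrals into equality at a dense set of levels. *)
Lemma eq_in_itv_of_integral_le (R : realType) (A B : R -> \bar R) :
  measurable_fun `[(0 : R), +oo[ A -> measurable_fun `[(0 : R), +oo[ B ->
  (forall s, 0 <= s -> (0 <= B s)%E) ->
  (forall s, 0 <= s -> (B s <= A s)%E) ->
  (forall s, 0 <= s -> (A s < +oo)%E) ->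
  (\int[lebesgue_measure]_(s in `[(0 : R)%R, +oo[) A s <=
   \int[lebesgue_measure]_(s in `[(0 : R)%R, +oo[) B s)%E ->
  (\int[lebesgue_measure]_(s in `[(0 : R)%R, +oo[) B s < +oo)%E ->
  forall a b : R, 0 <= a -> a < b -> exists2 s, a < s < b & A s = B s.
Proof.
set D := (X in measurable_fun X).
have DP s : D s = (0 <= s) :> Prop by rewrite /D /= in_itv/= andbT.
move=> mA mB B0 BA Afin AB Bfin a b a0 ab.
have A0 s : 0 <= s -> (0 <= A s)%E.
  by move=> s0; exact: le_trans (B0 _ s0) (BA _ s0).
have mD : measurable D by exact: measurable_itv.
have finB s : 0 <= s -> B s \is a fin_num.
  by move=> s0; rewrite ge0_fin_numE ?B0// (le_lt_trans (BA _ s0)) ?Afin.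
have iB : lebesgue_measure.-integrable D B.
  apply/integrableP; split => //.
  rewrite (@eq_integral _ _ _ lebesgue_measure D B)// => s; rewrite inE DP => s0.
  by rewrite gee0_abs// B0.
have iA : lebesgue_measure.-integrable D A.
  apply/integrableP; split => //.
  rewrite (@eq_integral _ _ _ lebesgue_measure D A) ?(le_lt_trans AB)// => s; rewrite inE DP => s0.
  by rewrite gee0_abs// A0.
have AB0 s : D s -> (0 <= A s - B s)%E.
  by rewrite DP => s0; rewrite sube_ge0 ?BA// finB// orbT.
have mAB : measurable_fun D (A \- B)%E by exact: emeasurable_funB.
have int0 : (\int[lebesgue_measure]_(s in D) (`| (A \- B) s |)  = 0)%E.
  rewrite (@eq_integral _ _ _ lebesgue_measure D (fun s => A s - B s)%E); last first.
    by move=> s; rewrite inE => Ds /=; rewrite gee0_abs// AB0.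
  apply/eqP; rewrite eq_le; apply/andP; split; last exact: integral_ge0.
  rewrite integralB// sube_le0//.
have [N [mN N0 subN]] : ae_eq lebesgue_measure D (A \- B)%E (cst 0%E).
  by apply/ae_eq_integral_abs.
apply: contrapT => /forall2NP noeq.
have : (lebesgue_measure `]a, b[ <= lebesgue_measure N)%E.
  apply: le_measure; rewrite ?inE//.
  move=> s /=; rewrite in_itv/= => sab; apply: subN => /= Ds.
  have s0 : 0 <= s by move: sab => /andP[/ltW/(le_trans a0)].
  have {}Ds := Ds ltac:(by rewrite DP).
  case: (noeq s) => //; apply.
  apply/eqP; move/eqP: Ds; rewrite sube_eq ?add0e//.
  by rewrite ge0_fin_numE ?A0 ?Afin.
by rewrite N0 lebesgue_measure_itv/= lte_fin ab -EFinD lee_fin subr_le0 leNgt ab.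
Qed.

(** * The symmetric decreasing rearrangement *)

Section symmetric_rearrangement.
Variables (R : realType) (f : R -> R).
Hypotheses (mf : measurable_fun setT f) (f0 : forall x, 0 <= f x).
Local Notation lambda := (@lebesgue_measure R).

(** The distribution function of [f] on [-pi, pi]; [fstar] is its generalized inverse away from the
    endpoints 0 and 2 pi. *)
Definition distr (s : R) : \bar R := leb_pipi [set x | s < f x].

Lemma measurable_superlevel s : measurable [set x | s < f x].
Proof.
have := mf measurableT (measurable_itv `]s, +oo[%R).
rewrite setTI; congr measurable.
by apply/seteqP; split => x /=; rewrite in_itv/= andbT.
Qed.

Lemma leb_pipi_setT : @leb_pipi R setT = (2 * pi)%:E.
Proof.
rewrite /leb_pipi /mrestr setTI lebesgue_measure_itv/= lte_fin.
have := pi_gt0 R => p0.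
by rewrite ifT ?gtrN// -EFinD opprK mulr_natl mulr2n.
Qed.

Lemma distr_le s : (distr s <= (2 * pi)%:E)%E.
Proof.
rewrite -leb_pipi_setT /distr /leb_pipi /mrestr; apply: le_measure => //.
- by rewrite inE; apply: measurableI; [exact: measurable_superlevel|].
- by rewrite inE setTI.
- exact: setSI.
Qed.

Lemma fin_num_distr s : distr s \is a fin_num.
Proof.
by rewrite ge0_fin_numE ?(le_lt_trans (distr_le s)) ?ltry//; exact: measure_ge0.
Qed.

Lemma distr_neg s : s < 0 -> distr s = (2 * pi)%:E.
Proof.
move=> s0; rewrite -leb_pipi_setT; congr leb_pipi.
by apply/seteqP; split => // x _ /=; exact: lt_le_trans s0 (f0 x).
Qed.

Lemma le_distr s t : s <= t -> (distr t <= distr s)%E.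
Proof.
move=> st; rewrite /distr /leb_pipi /mrestr; apply: le_measure.
- by rewrite inE; apply: measurableI; [exact: measurable_superlevel|].
- by rewrite inE; apply: measurableI; [exact: measurable_superlevel|].
- by apply: setSI => x /=; exact: le_lt_trans.
Qed.

(** The set {f > s} is the increasing union of the sets {f > s + 1/(n+1)}, so continuity from below
    applies. Together with [le_distr] this amounts to right continuity, in the form that [lt_fsharp]
    needs. *)
Lemma distr_right_continuous s (t : \bar R) : (t < distr s)%E ->
  exists2 e, s < e & (t < distr e)%E.
Proof.
move=> ts; apply: contrapT => /forall2NP H.
pose F n := [set x | s + n.+1%:R^-1 < f x] `&` `[- pi, pi].
have mF n : measurable (F n).
  by apply: measurableI => //; exact: measurable_superlevel.
have FE : \bigcup_n F n = [set x | s < f x] `&` `[- pi, pi].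
  rewrite -setI_bigcupl; congr (_ `&` _); apply/seteqP; split => x /=.
    by move=> [n _ /=]; apply: le_lt_trans; rewrite lerDl.
  rewrite -subr_gt0 => sf.
  have [n _ /(_ _ (leqnn _)) /= nlt] := near_infty_natSinv_lt (PosNum sf).
  by exists n => //=; rewrite addrC -ltrBrDr.
have mUF : measurable (\bigcup_n F n) by exact: bigcup_measurable.
have ndF : {homo F : n m / (n <= m)%N >-> (n <= m)%O}.
  move=> n m nm; apply/subsetPset; apply: setSI => x /=; apply: le_lt_trans.
  by rewrite lerD2l lef_pV2 ?posrE// ler_nat.
suff : (distr s <= t)%E by rewrite leNgt ts.
rewrite /distr /leb_pipi /mrestr -FE.
apply: cvge_le (nondecreasing_cvg_mu (mu := lambda) mF mUF ndF).
apply: nearW => n /=; rewrite leNgt; apply/negP => tF.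
by have [|] := H (s + n.+1%:R^-1); [rewrite ltrDl invr_gt0 ltr0n|].
Qed.

Lemma fsharpE t : 0 < `|t| < pi -> fsharp f t =
  ereal_inf [set s%:E | s in [set s : R | (distr s <= (2 * `|t|)%:E)%E]].
Proof.
move=> /andP[t0 tpi]; rewrite /fsharp /fstar ltW// mulf_eq0 pnatr_eq0/=.
by rewrite gt_eqF// lt_eqF// ltr_pM2l.
Qed.

(** Inversion of the generalized inverse: by monotonicity and right continuity of [distr], a strict
    excess of [distr] at [s] persists at some larger level, which then bounds the infimum from
    below. Hence the superlevel sets of [fsharp f] are centred intervals, up to the point 0. *)
Lemma lt_fsharp t s : 0 < `|t| < pi ->
  (s%:E < fsharp f t)%E = ((2 * `|t|)%:E < distr s)%E.
Proof.
move=> tpi; rewrite fsharpE//; apply/idP/idP; apply: contraTT.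
  rewrite -!leNgt => H; apply: ge_ereal_inf; exists s%:E => //.
  by exists s.
rewrite -leNgt => H; rewrite -leNgt leNgt; apply/negP.
move=> /distr_right_continuous[e se te].
have : (e%:E <= s%:E)%E; last by rewrite lee_fin leNgt se.
apply: le_trans H; apply/ereal_infP => _ [r /= rt <-].
rewrite lee_fin leNgt; apply/negP => /ltW /le_distr re.
by move: te; rewrite ltNge (le_trans re rt).
Qed.

Lemma fsharp_ge0 t : `|t| < pi -> (0 <= fsharp f t)%E.
Proof.
move=> t1; have [->|t0] := eqVneq t 0.
  rewrite /fsharp normr0 pi_ge0 mulr0 /fstar eqxx; apply: ess_sup_ger => //.
  apply: (@lt_le_trans _ _ (2 * pi)%:E); first by rewrite lte_fin mulr_gt0 ?pi_gt0.
  by rewrite -leb_pipi_setT.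
rewrite fsharpE ?normr_gt0 ?t0//; apply/ereal_infP => _ [r /= rt <-].
rewrite lee_fin leNgt; apply/negP => /distr_neg rE.
by move: rt; rewrite rE lee_fin leNgt ltr_pM2l// t1.
Qed.

Lemma IopE t : @Iop R t = (`|t| < pi) :> Prop.
Proof. by rewrite /Iop /= in_itv/= -ltr_norml. Qed.

Lemma measurable_Iop : measurable (@Iop R).
Proof. exact: measurable_itv. Qed.

Lemma measurable_Iop0 : measurable (@Iop R `\ 0).
Proof. by apply: measurableD => //; exact: measurable_Iop. Qed.

Lemma Iop0E t : (@Iop R `\ 0) t = (0 < `|t| < pi) :> Prop.
Proof.
rewrite propeqE; split.
  by move=> [+ /eqP t0]; rewrite IopE normr_gt0 t0 => ->.
by move=> /andP[]; rewrite normr_gt0 => /eqP t0 tpi; split => //; rewrite IopE.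
Qed.

(** Away from 0 the superlevel sets are given by a condition on [|t|] through [lt_fsharp]. The point
    0, where [fstar] is an essential supremum, is treated as a singleton. *)
Lemma measurable_fsharp : measurable_fun (@Iop R) (fsharp f).
Proof.
have -> : @Iop R = (@Iop R `\ 0) `|` [set 0].
  by rewrite setDKU// => _ ->; rewrite IopE normr0 pi_gt0.
apply/measurable_funU => //; first exact: measurable_Iop0.
split; last exact: measurable_fun_set1.
move=> _; apply: (measurability _ (ErealGenOInfty.measurableE R)) => //.
move=> /= _ [_ [s ->]] <-.
rewrite (_ : _ `&` _ = (@Iop R `\ 0) `&` [set t | ((2 * `|t|)%:E < distr s)%E]); last first.
  apply/seteqP; split => t [It] /=; split => //; move: (It); rewrite Iop0E => tpi.
    by rewrite -lt_fsharp//; move: b; rewrite in_itv/= andbT.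
  by rewrite /= in_itv/= andbT lt_fsharp.
apply: emeasurable_fun_infty_o; first exact: measurable_Iop0.
apply/measurable_EFinP; apply: measurable_funM; first exact: measurable_cst.
exact: normr_measurable.
exact: measurable_Iop0.
Qed.

End symmetric_rearrangement.

(** * Integrals of the rearrangement over centred intervals *)

Section rearrangement_inequality.
Variables (R : realType) (f : R -> R).
Hypotheses (mf : measurable_fun setT f) (f0 : forall x, 0 <= f x).
Local Notation lambda := (@lebesgue_measure R).

Lemma lebesgue_measure_setD1 (A : set R) (a : R) : measurable A ->
  lambda (A `\ a) = lambda A.
Proof.
move=> mA; rewrite [RHS](@measureDI _ _ _ lambda A [set a])//.
rewrite (@subset_measure0 _ _ _ lambda (A `&` [set a]) [set a]) ?adde0//.
- exact: measurableI.
- exact: lebesgue_measure_set1.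
Qed.

Lemma lebesgue_measure_sym_itv (r : R) : 0 <= r ->
  lambda `]- r, r[%classic = (2 * r)%:E.
Proof.
move=> r0; rewrite lebesgue_measure_itv/= lte_fin.
case: ltP => [_|rr]; first by rewrite -EFinD opprK mulr_natl mulr2n.
have -> : r = 0 by lra.
by rewrite mulr0.
Qed.

Lemma sub_itv_Iop (r : R) : r <= pi -> `]- r, r[%classic `<=` @Iop R.
Proof.
by move=> rpi t /=; rewrite in_itv/= -ltr_norml IopE => /lt_le_trans; exact.
Qed.

(* 0 is removed because f^#(0) is an essential supremum, possibly +oo. *)
Lemma measure_fsharp_superlevel (r s : R) : 0 <= r <= pi ->
  lambda ((`]- r, r[%classic `\ 0) `&` [set t | (s%:E < fsharp f t)%E]) =
  mine (2 * r)%:E (distr f s).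
Proof.
move=> /andP[r0 rpi].
(* The superlevel set of [fsharp f] has half-width [distr f s / 2]; intersecting it with the centred
   interval of half-width [r] leaves the smaller of the two. *)
pose rho := Num.min r (fine (distr f s) / 2).
have rho0 : 0 <= rho.
  by rewrite le_min r0 divr_ge0// fine_ge0// measure_ge0.
have dE : distr f s = (fine (distr f s))%:E by rewrite fineK// fin_num_distr.
rewrite (_ : _ `&` _ = `]- rho, rho[ `\ 0).
  rewrite lebesgue_measure_setD1// lebesgue_measure_sym_itv// dE -EFin_min.
  congr EFin; rewrite /rho; set x := fine _.
  by case: (leP r (x / 2)) => ?; case: (leP (2 * r) x) => ?; lra.
apply/seteqP; split => t /=; rewrite !in_itv/= -!ltr_norml lt_min.
  move=> [[tr /eqP t0]]; have tpi := lt_le_trans tr rpi.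
  rewrite lt_fsharp ?normr_gt0 ?t0//= dE lte_fin => td.
  by split; [rewrite tr ltr_pdivlMr// mulrC|exact/eqP].
move=> [/andP[tr td] /eqP t0]; have tpi := lt_le_trans tr rpi.
split; first by split => //; exact/eqP.
rewrite lt_fsharp ?normr_gt0 ?t0//= dE lte_fin.
by rewrite mulrC -ltr_pdivlMr.
Qed.

Lemma measurable_sym_itv0 (r : R) : measurable (`]- r, r[%classic `\ 0 : set R).
Proof. by apply: measurableD. Qed.

Lemma measurable_fsharp_sub (r : R) : r <= pi ->
  measurable_fun (`]- r, r[%classic `\ 0) (fsharp f).
Proof.
move=> rpi; apply: measurable_funS (measurable_fsharp mf).
  exact: measurable_Iop.
by move=> t [/(sub_itv_Iop rpi)].
Qed.

Lemma integral_fsharp_layer_cake (r : R) : 0 <= r <= pi ->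
  (\int[lambda]_(t in `](- r)%R, r[) fsharp f t =
   \int[lambda]_(s in `[(0 : R)%R, +oo[) mine (2 * r)%:E (distr f s))%E.
Proof.
move=> /[dup] r0pi /andP[r0 rpi]; rewrite -(@integral_setD1 _ _ 0).
- rewrite layer_cake.
  + by apply: eq_integral => s _; exact: measure_fsharp_superlevel.
  + exact: measurable_sym_itv0.
  + exact: measurable_fsharp_sub.
  + move=> t [/(sub_itv_Iop rpi)]; rewrite IopE => tpi _.
    exact: fsharp_ge0.
- exact: measurable_sym_itv0.
- exact: measurable_fsharp_sub.
Qed.

Lemma measurable_min_distr (r : R) : 0 <= r <= pi ->
  measurable_fun `[(0 : R), +oo[ (fun s => mine (2 * r)%:E (distr f s)).
Proof.
move=> /[dup] r0pi /andP[r0 rpi].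
have := measurable_distribution lambda (measurable_sym_itv0 r) (measurable_fsharp_sub rpi).
by apply: eq_measurable_fun => s _; exact: measure_fsharp_superlevel.
Qed.

(** The part of a superlevel set of [g] inside [E] has measure at most [2 * r] and at most
    [distr f s], and the minimum of the two is the layer cake integrand of [fsharp f]. A general [g]
    is allowed so that both [f] and [fsharp f] can be inserted. *)
Lemma integral_le_fsharp (g : R -> \bar R) (E : set R) (r : R) :
  measurable_fun (@Iop R) g -> (forall t, `|t| < pi -> (0 <= g t)%E) ->
  (forall s, 0 <= s ->
    (lambda (@Iop R `&` [set t | s%:E < g t]) <= distr f s)%E) ->
  measurable E -> E `<=` @Iop R -> 0 <= r <= pi -> (lambda E <= (2 * r)%:E)%E ->
  (\int[lambda]_(t in E) g t <= \int[lambda]_(t in `](- r)%R, r[) fsharp f t)%E.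
Proof.
move=> mg g0 gd mE EI r0pi Er.
have mgE : measurable_fun E g.
  by apply: measurable_funS mg => //; exact: measurable_Iop.
rewrite integral_fsharp_layer_cake// layer_cake//; last first.
  by move=> t /EI; rewrite IopE; exact: g0.
apply: ge0_le_integral => //=.
- exact: measurable_distribution.
- exact: measurable_min_distr.
- move=> s; rewrite in_itv/= andbT => s0.
  have mEs : measurable (E `&` [set x | (s%:E < g x)%E]).
    exact: emeasurable_fun_o_infty.
  rewrite le_min; apply/andP; split.
    by apply: le_trans Er; apply: le_measure; rewrite ?inE//; exact: subIsetl.
  apply: le_trans (gd _ s0); apply: le_measure; rewrite ?inE//; last exact: setSI.
  by apply: emeasurable_fun_o_infty => //; exact: measurable_Iop.
Qed.

(** Equimeasurability: at [r = pi] the truncation by [2 * r] has no effect, since [distr] never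
    exceeds 2 pi. *)
Lemma integral_fsharp_Iop :
  (\int[lambda]_(t in @Iop R) fsharp f t = \int[lambda]_(t in @Icl R) (f t)%:E)%E.
Proof.
rewrite /Iop integral_fsharp_layer_cake ?pi_ge0 ?lexx//.
rewrite [RHS]layer_cake//.
- apply: eq_integral => s _; rewrite min_r ?distr_le//.
  by rewrite /distr /leb_pipi /mrestr setIC.
- exact: measurable_itv.
- by apply/measurable_EFinP; exact: measurable_funTS.
- by move=> t _; rewrite lee_fin.
Qed.

Lemma measure_superlevel_le_distr s :
  (lambda (@Iop R `&` [set t | s%:E < (f t)%:E]) <= distr f s)%E.
Proof.
rewrite /distr /leb_pipi /mrestr setIC; apply: le_measure; rewrite ?inE.
- by apply: measurableI => //; [exact: measurable_superlevel | exact: measurable_Iop].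
- by apply: measurableI => //; exact: measurable_superlevel.
- by apply: setIS => t; rewrite /Iop/= !in_itv/= => /andP[/ltW -> /ltW ->].
Qed.

Lemma measure_fsharp_superlevel_le_distr s :
  (lambda (@Iop R `&` [set t | s%:E < fsharp f t]) <= distr f s)%E.
Proof.
have mI : measurable (@Iop R `&` [set t | (s%:E < fsharp f t)%E]).
  by apply: emeasurable_fun_o_infty; [exact: measurable_Iop|exact: measurable_fsharp].
rewrite -(lebesgue_measure_setD1 0)//.
have <- := @min_r _ _ (2 * pi)%:E _ (distr_le mf s).
rewrite -measure_fsharp_superlevel ?pi_ge0 ?lexx//.
by rewrite -setIDA -setIDAC.
Qed.

End rearrangement_inequality.

(** * The equality case of the rearrangement inequality *)

Section rearrangement_equality.
Variables (R : realType) (f : R -> R).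
Hypotheses (mf : measurable_fun setT f) (f0 : forall x, 0 <= f x).
Hypothesis f_int : (\int[@lebesgue_measure R]_(x in @Icl R) (f x)%:E < +oo)%E.
Local Notation lambda := (@lebesgue_measure R).

Let mfE D : measurable_fun D (fun x => (f x)%:E).
Proof. by apply/measurable_EFinP; exact: measurable_funTS. Qed.

Let Icl_Iop : @Iop R `<=` @Icl R.
Proof. by move=> t; rewrite /Iop /Icl/= !in_itv/= => /andP[/ltW -> /ltW ->]. Qed.

Let mIcl : measurable (@Icl R). Proof. exact: measurable_itv. Qed.

(** The layer cake integrands of [fsharp f] and [f] must agree at some level [s] between [p] and
    [q]. There [distr f s] is still at least [2 * r], so {f > s} fills the interval ]-r, r[ up to a
    null set, which leaves no mass for {f <= p}. *)
Lemma integral_sym_itv_eq_superlevel (r p q : R) : 0 <= r <= pi ->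
  (\int[lambda]_(t in `](- r)%R, r[) fsharp f t <=
   \int[lambda]_(t in `](- r)%R, r[) (f t)%:E)%E ->
  0 <= p -> p < q -> ((2 * r)%:E <= distr f q)%E ->
  lambda ((`]- r, r[%classic `\ 0) `&` [set t | f t <= p]) = 0%E.
Proof.
move=> /[dup] r0pi /andP[r0 rpi] fr p0 pq rq.
set J := `]- r, r[%classic `\ 0.
have mJ : measurable J by exact: measurable_sym_itv0.
have JI : J `<=` @Iop R by move=> t [/(sub_itv_Iop rpi)].
have lJ : lambda J = (2 * r)%:E by rewrite lebesgue_measure_setD1// lebesgue_measure_sym_itv.
have mJs s : measurable (J `&` [set t | s < f t]).
  by apply: measurableI => //; exact: measurable_superlevel.
have intJ (g : R -> \bar R) : measurable_fun J g ->
    (\int[lambda]_(t in J) g t = \int[lambda]_(t in `](- r)%R, r[) g t)%E.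
  by move=> mg; rewrite integral_setD1.
have LCf : (\int[lambda]_(t in `](- r)%R, r[) (f t)%:E =
    \int[lambda]_(s in `[(0 : R)%R, +oo[) lambda (J `&` [set t | (s < f t)%R]))%E.
  transitivity (\int[lambda]_(t in J) (f t)%:E)%E.
    by apply/esym; apply: intJ; exact: mfE.
  rewrite layer_cake//; first exact: mfE.
  by move=> t _; rewrite lee_fin.
have fJfin : (\int[lambda]_(t in `](- r)%R, r[) (f t)%:E < +oo)%E.
  apply: le_lt_trans f_int; apply: ge0_subset_integral => //.
  - exact: mfE.
  - by move=> t _; rewrite lee_fin.
  - by move=> t /(sub_itv_Iop rpi)/Icl_Iop.
have [s /andP[ps sq] As] : exists2 s, p < s < q &
    mine (2 * r)%:E (distr f s) = lambda (J `&` [set t | s < f t]).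
  apply: (eq_in_itv_of_integral_le _ _ _ _ _ _ _ p0 pq).
  - exact: measurable_min_distr.
  - exact: (measurable_distribution lambda mJ (@mfE J)).
  - by move=> s _; exact: measure_ge0.
  - move=> s _; rewrite le_min -lJ; apply/andP; split.
      by apply: le_measure; rewrite ?inE; [exact: mJs|exact: mJ|exact: subIsetl].
    apply: le_trans (measure_superlevel_le_distr mf s).
    apply: le_measure; rewrite ?inE; [exact: mJs| |exact: setSI].
    by apply: measurableI => //; [exact: measurable_Iop|exact: measurable_superlevel].
  - by move=> s _; rewrite gt_min ltry.
  - by rewrite -LCf -integral_fsharp_layer_cake.
  - by rewrite -LCf.
rewrite min_l in As; last first.
  by apply: le_trans rq _; apply: le_distr => //; exact: ltW.
have mJp : measurable (J `&` [set t | f t <= p]).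
  rewrite (_ : _ `&` _ = J `\` [set t | p < f t]).
    by apply: measurableD => //; exact: measurable_superlevel.
  by apply/seteqP; split => t /= [Jt] => [|/negP]; rewrite leNgt => ?; split => //; exact/negP.
apply: (@subset_measure0 _ _ _ lambda _ (J `\` [set t | s < f t])) => //.
- by apply: measurableD => //; exact: measurable_superlevel.
- move=> t /= [Jt fp]; split => //; apply/negP; rewrite -leNgt.
  exact: le_trans fp (ltW _).
- have lJy : (lambda J < +oo)%E by rewrite lJ ltry.
  transitivity (lambda J - lambda (J `&` [set t | (s < f t)%R]))%E.
    by apply: measureD => //; exact: measurable_superlevel.
  by rewrite -As lJ subee.
Qed.

Hypothesis dense_eq : forall a b : R, 0 <= a -> a < b -> b <= pi ->
  exists2 r, a < r < b &
  (\int[lambda]_(t in `](- r)%R, r[) fsharp f t <=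
   \int[lambda]_(t in `](- r)%R, r[) (f t)%:E)%E.

(** Each [t] other than 0 with [f t < fsharp f t] is caught by rationals p < q between the two
    values and a rational radius [a] above [|t|] with [2 * a] below [distr f q]. Each such triple
    accounts for a null set only, and there are countably many triples. *)
Lemma ae_fsharp_le : {ae lambda, forall t, @Iop R t -> (fsharp f t <= (f t)%:E)%E}.
Proof.
pose good (w : rat * rat * rat) := [/\ 0 <= ratr w.1.1 :> R, 0 <= ratr w.1.2 :> R,
  ratr w.1.2 < ratr w.2 :> R, ratr w.1.1 < pi :> R
  & ((2 * ratr w.1.1)%:E < distr f (ratr w.2))%E].
pose bad (w : rat * rat * rat) : set R :=
  (`]- (ratr w.1.1), (ratr w.1.1)[%classic `\ 0) `&` [set t | f t <= ratr w.1.2].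
have bad0 w : good w -> lambda.-negligible (bad w).
  case: w => -[a p] q [/= a0 p0 pq api aq].
  (* Radii below [b] stay inside the interval and satisfy [2 * r <= distr f q], as the level
     argument requires; [dense_eq] then supplies one above [a]. *)
  pose b := Num.min pi (fine (distr f (ratr q)) / 2).
  have dE : distr f (ratr q) = (fine (distr f (ratr q)))%:E by rewrite fineK// fin_num_distr.
  have ab : ratr a < b.
    by rewrite lt_min api/= ltr_pdivlMr// mulrC -lte_fin -dE.
  have bpi : b <= pi by rewrite ge_min lexx.
  have [r /andP[ar rb] fr] := dense_eq a0 ab bpi.
  move: rb; rewrite lt_min => /andP[rpi rd].
  have r0pi : 0 <= r <= pi by rewrite (le_trans a0 (ltW ar)) ltW.
  exists ((`]- r, r[%classic `\ 0) `&` [set t | f t <= ratr p]); split.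
  - apply: measurableI; first exact: measurable_sym_itv0.
    rewrite (_ : [set _ | _] = ~` [set t | ratr p < f t]).
      by apply: measurableC; exact: measurable_superlevel.
    by apply/seteqP; split => t /=; rewrite leNgt => /negP.
  - apply: (integral_sym_itv_eq_superlevel r0pi fr p0 pq).
    by rewrite dE lee_fin mulrC -ler_pdivlMr// ltW.
  - move=> t [[]]; rewrite /= !in_itv/= -!ltr_norml => ta t0 fp.
    by split => //; split => //; exact: lt_trans ar.
(* The set of all [t] with [good w] is everything or empty, so intersecting with it discards the
   triples that are not good. *)
pose F k := if unpickle k is Some w then bad w `&` [set t | good w] else set0.
have : lambda.-negligible ([set 0] `|` \bigcup_k F k).
  apply: negligibleU.
    by apply/negligibleP => //; exact: lebesgue_measure_set1.
  apply: negligible_bigcup => k; rewrite /F.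
  case: unpickle => [w|]; last exact: negligible_set0.
  have [gw|ngw] := pselect (good w).
    by apply: negligibleS (bad0 w gw) => t [].
  by apply: negligibleS (negligible_set0 lambda) => t [].
apply: negligibleS => t /= /not_implyP[It] /negP; rewrite -ltNge => ft.
have [->|t0] := eqVneq t 0; [by left|right].
have tpi : `|t| < pi by rewrite -IopE.
have t0pi : 0 < `|t| < pi by rewrite normr_gt0 t0.
have [q' fq' q't] : exists2 q' : R, f t < q' & (q'%:E < fsharp f t)%E.
  case: (fsharp f t) ft => [y| |] //; last by exists (f t + 1); rewrite ?ltrDl ?ltry.
  rewrite lte_fin => fy; exists ((f t + y) / 2); rewrite ?lte_fin; lra.
have [q] := rat_in_itvoo fq'; rewrite in_itv/= => /andP[fq qq'].
have [p] := rat_in_itvoo fq; rewrite in_itv/= => /andP[fp pq].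
have {q't} : ((ratr q)%:E < fsharp f t)%E by apply: lt_trans q't; rewrite lte_fin.
rewrite (lt_fsharp mf)// => tq.
have dE : distr f (ratr q) = (fine (distr f (ratr q)))%:E by rewrite fineK// fin_num_distr.
have tb : `|t| < Num.min pi (fine (distr f (ratr q)) / 2).
  by rewrite lt_min tpi/= ltr_pdivlMr// mulrC -lte_fin -dE.
have [a] := rat_in_itvoo tb; rewrite in_itv/= lt_min => /andP[ta /andP[api aq]].
exists (pickle (a, p, q)); [exact: I|rewrite /F pickleK; split].
  split; last by rewrite /= ltW.
  by split; [rewrite /= in_itv/= -ltr_norml|exact/eqP].
split => //=.
- exact: le_trans (ltW ta).
- exact: le_trans (ltW fp).
- by rewrite dE lte_fin mulrC -ltr_pdivlMr.
Qed.

(** Almost everywhere [fsharp f] is at most [f], while the total integral of [f] is at most that of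
    [fsharp f]. Splitting the interval into [A] and its complement, neither piece can have a strict
    inequality; finiteness of the integral allows the cancellation. *)
Lemma integral_fsharp_eq (A : set R) : measurable A ->
  (\int[lambda]_(t in A `&` @Iop R) (f t)%:E =
   \int[lambda]_(t in A `&` @Iop R) fsharp f t)%E.
Proof.
move=> mA.
have mI := @measurable_Iop R.
have mAI : measurable (A `&` @Iop R) by exact: measurableI.
have mAcI : measurable (~` A `&` @Iop R) by apply: measurableI => //; exact: measurableC.
have le B : measurable B -> B `<=` @Iop R ->
    (\int[lambda]_(t in B) fsharp f t <= \int[lambda]_(t in B) (f t)%:E)%E.
  move=> mB BI; apply: ae_ge0_le_integral => //.
  - by move=> t /BI; rewrite IopE; exact: fsharp_ge0.
  - by apply: measurable_funS (measurable_fsharp mf).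
  - by move=> t _; rewrite lee_fin.
  - exact: mfE.
  - by apply: (negligibleS _ ae_fsharp_le) => t /= nH H; apply: nH => /BI; exact: H.
have split (g : R -> \bar R) : measurable_fun (@Iop R) g ->
    (forall t, @Iop R t -> (0 <= g t)%E) ->
    (\int[lambda]_(t in @Iop R) g t =
     \int[lambda]_(t in A `&` @Iop R) g t + \int[lambda]_(t in ~` A `&` @Iop R) g t)%E.
  move=> mg g0; have IE : @Iop R = (A `&` @Iop R) `|` (~` A `&` @Iop R).
    by rewrite -setIUl setUv setTI.
  rewrite {1}IE ge0_integral_setU//.
  - by rewrite -IE.
  - by rewrite -IE.
  - by apply/disj_setPS => t [[At _] [/(_ At)]].
have Sf := split _ (@mfE _) (fun t _ => _ : (0 <= (f t)%:E)%E).
have Sfs := split _ (measurable_fsharp mf) _.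
have fin_f : (\int[lambda]_(t in @Iop R) (f t)%:E < +oo)%E.
  apply: le_lt_trans f_int; apply: ge0_subset_integral => //.
  - exact: mfE.
  - by move=> t _; rewrite lee_fin.
have eqI : (\int[lambda]_(t in @Iop R) (f t)%:E <= \int[lambda]_(t in @Iop R) fsharp f t)%E.
  rewrite integral_fsharp_Iop//; apply: ge0_subset_integral => //.
  - exact: mfE.
  - by move=> t _; rewrite lee_fin.
apply/eqP; rewrite eq_le; apply/andP; split; last exact: (le _ mAI (@subIsetr _ _ _)).
move: eqI; rewrite Sf ?Sfs; [|by move=> ?; rewrite IopE; exact: fsharp_ge0|by move=> ?; rewrite lee_fin].
move=> eqI.
have fin_Ac : (\int[lambda]_(t in ~` A `&` @Iop R) (f t)%:E \is a fin_num)%E.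
  rewrite ge0_fin_numE; last by apply: integral_ge0 => t _; rewrite lee_fin.
  apply: le_lt_trans fin_f; apply: ge0_subset_integral => //.
  - exact: mfE.
  - by move=> t _; rewrite lee_fin.
rewrite -(leeD2rE _ _ fin_Ac); apply: le_trans eqI _.
by rewrite leeD2l//; exact: (le _ mAcI (@subIsetr _ _ _)).
Qed.

End rearrangement_equality.

(** * The Green kernel and its potentials *)

Section green_kernel.
Variable R : realType.
Implicit Types (x y s : R).

Let pi0 : 0 < pi :> R. Proof. exact: pi_gt0. Qed.

Lemma green_le x y : y <= x -> green x y = (pi - x) * (pi + y) / (2 * pi).
Proof.
move=> yx; rewrite /green ger0_norm ?subr_ge0//; have := lt0r_neq0 pi0; move: pi => p p0.
by field.
Qed.

Lemma green_ge x y : x <= y -> green x y = (pi + x) * (pi - y) / (2 * pi).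
Proof.
move=> xy; rewrite /green ler0_norm ?subr_le0//; have := lt0r_neq0 pi0; move: pi => p p0.
by field.
Qed.

Lemma green_ge0 x y : `|x| <= pi -> `|y| <= pi -> 0 <= green x y.
Proof.
rewrite !ler_norml => /andP[x1 x2] /andP[y1 y2].
have [yx|/ltW xy] := leP y x; [rewrite green_le//|rewrite green_ge//];
  by rewrite divr_ge0 ?mulr_ge0//; lra.
Qed.

Lemma measurable_green x : measurable_fun setT (green x).
Proof.
apply: continuous_measurable_fun => y; rewrite /green.
apply: cvgD; last exact: cvg_cst.
apply: cvgB; apply: cvgMl.
  by apply: cvgN; apply: cvgMr; exact: cvg_id.
by apply: cvg_norm; apply: cvgB; [exact: cvg_cst|exact: cvg_id].
Qed.

Lemma continuous_greenl y : continuous (fun x => green x y).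
Proof.
move=> x; rewrite /green.
apply: cvgD; last exact: cvg_cst.
apply: cvgB; apply: cvgMl.
  by apply: cvgN; apply: cvgMl; exact: cvg_id.
by apply: cvg_norm; apply: cvgB; [exact: cvg_id|exact: cvg_cst].
Qed.

(** This is [green x x / green 0 0], the peak of the kernel at [x] relative to its peak pi / 2 at
    0. *)
Definition green_height x : R := 1 - x ^+ 2 / pi ^+ 2.

Lemma green_heightE x : green_height x = (pi - x) * (pi + x) / pi ^+ 2.
Proof.
by rewrite /green_height; have := lt0r_neq0 pi0; move: pi => p p0; field.
Qed.

(** Divided by [green_height x], the kernel is a tent that rises linearly from 0 at -pi to pi / 2 at
    [x] and falls linearly to 0 at pi. The bounds on [y] are the points where the two slopes reach
    the level [s]; their distance 2 (pi - 2 s) does not depend on [x]. *)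
Lemma green_superlevel x y s : `|x| < pi -> 0 <= s ->
  green_height x * s < green x y ->
  [/\ s < pi / 2, - pi + 2 * s / pi * (pi + x) < y
    & y < pi - 2 * s / pi * (pi - x)].
Proof.
rewrite ltr_norml green_heightE => /andP[x1 x2] s0.
(* The level as a fraction of the peak pi / 2. *)
pose c := 2 * s / pi.
have sE : s = c * pi / 2 by rewrite /c; have := lt0r_neq0 pi0; move: pi => p p0; field.
have c0 : 0 <= c by rewrite /c divr_ge0 ?mulr_ge0// ltW.
rewrite -/c.
have -> : (pi - x) * (pi + x) / pi ^+ 2 * s = c * (pi - x) * (pi + x) / (2 * pi).
  by rewrite sE; have := lt0r_neq0 pi0; move: pi => p p0; field.
have x1' : 0 < pi + x by lra.
have x2' : 0 < pi - x by lra.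
have [yx|/ltW xy] := leP y x.
  rewrite green_le// ltr_pM2r ?invr_gt0 ?mulr_gt0// [c * _]mulrC -mulrA ltr_pM2l//.
  move=> cy; have c1 : c < 1.
    by rewrite -(ltr_pM2r x1') mul1r; apply: lt_le_trans cy _; lra.
  have : c * (pi - x) < pi - x by rewrite -[ltRHS]mul1r ltr_pM2r.
  have : c * pi < pi by rewrite -[ltRHS]mul1r ltr_pM2r.
  by rewrite {1}sE; split; lra.
rewrite green_ge// ltr_pM2r ?invr_gt0 ?mulr_gt0// -mulrA [(pi - x) * _]mulrC mulrCA ltr_pM2l//.
move=> cy; have c1 : c < 1.
  by rewrite -(ltr_pM2r x2') mul1r; apply: lt_le_trans cy _; lra.
have : c * (pi + x) < pi + x by rewrite -[ltRHS]mul1r ltr_pM2r.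
have : c * pi < pi by rewrite -[ltRHS]mul1r ltr_pM2r.
by rewrite {1}sE; split; lra.
Qed.

Lemma green0E y : green 0 y = (pi - `|y|) / 2.
Proof. by rewrite /green !mul0r oppr0 mul0r !sub0r normrN; lra. Qed.

Lemma green0_superlevel s : 0 <= s ->
  @Icl R `&` [set y | (s%:E < (green 0 y)%:E)%E] =
  `](- (pi - 2 * s)), (pi - 2 * s)[%classic.
Proof.
move=> s0; apply/seteqP; split => y /=; rewrite in_itv/= -ltr_norml lte_fin green0E.
  by move=> [_]; lra.
move=> ys; split; last by lra.
by rewrite /Icl /= in_itv/= -ler_norml; lra.
Qed.

Lemma green_bound x y : `|y| <= pi -> `|green x y| <= `|x| + pi.
Proof.
move=> yp.
have h1 : `|x * y / (2 * pi)| <= `|x| / 2.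
  rewrite normrM normrM normfV [`|2 * pi|]gtr0_norm ?mulr_gt0//.
  rewrite ler_pdivrMr ?mulr_gt0//.
  have : `|x| * `|y| <= `|x| * pi by rewrite ler_wpM2l.
  by lra.
have h2 : `|x - y| <= `|x| + `|y| by exact: ler_normB.
have h3 : 0 <= `|x - y| by [].
have h4 : 0 <= `|x| by [].
rewrite /green mulNr ler_norml; move: h1; set a := x * y / _.
move: a => a; rewrite ler_norml => /andP[h11 h12].
by have := pi0; move=> ?; apply/andP; split; lra.
Qed.

End green_kernel.

(** * Finiteness and continuity of potentials *)

Section potential.
Variable R : realType.
Local Notation lambda := (@lebesgue_measure R).
Implicit Types m : {measure set R -> \bar R}.

Let mIcl : measurable (@Icl R). Proof. exact: measurable_itv. Qed.

Let mgreen D (x : R) : measurable_fun D (fun y => (green x y)%:E).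
Proof. by apply/measurable_EFinP; apply: measurable_funTS; exact: measurable_green. Qed.

Lemma IclE (y : R) : @Icl R y = (`|y| <= pi) :> Prop.
Proof. by rewrite /Icl /= in_itv/= -ler_norml. Qed.

Let integrable_cst m (k : R) : (m setT < +oo)%E ->
  m.-integrable (@Icl R) (EFin \o cst k).
Proof.
move=> m_fin; apply/integrableP; split; first exact/measurable_EFinP.
rewrite (_ : (fun _ => _) = cst (`|k|%:E)); last by apply/funext.
rewrite integral_cst// lte_mul_pinfty// ?lee_fin//.
by apply: le_lt_trans m_fin; apply: le_measure; rewrite ?inE.
Qed.

Lemma integrable_green m (x : R) : (m setT < +oo)%E ->
  m.-integrable (@Icl R) (EFin \o green x).
Proof.
move=> m_fin; apply: (@le_integrable _ _ _ m _ mIcl _ (EFin \o cst (`|x| + pi))).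
- exact: mgreen.
- move=> y; rewrite IclE => yp /=; rewrite lee_fin.
  by rewrite (le_trans (green_bound x yp))// ler_norm.
- exact: integrable_cst.
Qed.

Lemma upotE m (x : R) : (m setT < +oo)%E ->
  upot m x = (\int[m]_(y in @Icl R) green x y)%:E.
Proof.
move=> m_fin; rewrite /Rintegral fineK//.
exact: integrable_fin_num (integrable_green x m_fin).
Qed.

Lemma upot_ge0 m (x : R) : `|x| <= pi -> (0 <= upot m x)%E.
Proof.
move=> xp; apply: integral_ge0 => y; rewrite IclE => yp.
by rewrite lee_fin green_ge0.
Qed.

(** The potential is continuous by dominated convergence, so the extreme value theorem applies on
    the compact interval. *)
Lemma upot_attains_sup m : (m setT < +oo)%E ->
  exists2 x0, x0 \in @Icl R & upot m x0 = ereal_sup (upot m @` @Icl R).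
Proof.
move=> m_fin.
have pi0 := pi_gt0 R.
(* Continuity is proved on the larger open interval ]-2 pi, 2 pi[ so that -pi and pi become interior
   points; there [green_bound] gives the constant bound 3 pi. *)
have int_g x : `](- (2 * pi))%R, (2 * pi)%R[%classic x -> m.-integrable (@Icl R) (EFin \o green x).
  by move=> _; exact: integrable_green.
have cg : {ae m, forall y : R, @Icl R y ->
    {in `](- (2 * pi))%R, (2 * pi)%R[%classic, continuous (fun x => green x y)}}.
  by apply: aeW => y _ x _; exact: continuous_greenl.
have bg (x : R) : `](- (2 * pi))%R, (2 * pi)%R[%classic x ->
    {ae m, forall y : R, @Icl R y -> `|green x y| <= cst (3 * pi) y}.
  rewrite /= in_itv/= -ltr_norml => xp; apply: aeW => y.
  by rewrite IclE => yp; apply: le_trans (green_bound x yp) _; lra.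
have cont := continuity_under_integral mIcl int_g cg (integrable_cst _ m_fin) bg.
have [||c cpi cmax] := @EVT_max R (fun x => \int[m]_(y in @Icl R) green x y) (- pi) pi.
- lra.
- apply: continuous_in_subspaceT => x; rewrite inE/= in_itv/= => /andP[x1 x2].
  by apply: cont; rewrite inE/= in_itv/=; lra.
exists c; first by rewrite inE.
apply/eqP; rewrite eq_le; apply/andP; split.
  by apply: ereal_sup_ubound; exists c.
apply: ge_ereal_sup => _ [x xI <-].
by rewrite !upotE// lee_fin cmax.
Qed.

(** * Comparison of potentials of measures ordered by concentration at the centre *)

Section comparison.
Variables m m' : {measure set R -> \bar R}.
Hypotheses (m_fin : (m setT < +oo)%E) (m'_fin : (m' setT < +oo)%E).
Hypothesis dominated : forall (E : set R) (r : R), measurable E -> E `<=` @Iop R ->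
  0 < r <= pi -> (lambda E <= (2 * r)%:E)%E -> (m E <= m' `](- r)%R, r[%classic)%E.

(** After division of the kernel by [green_height x], the hypothesis [dominated] compares the layer
    cake integrands level by level, with radius [pi - 2 * s]. The measure [m] is kept general: it is
    later both the original measure and the symmetrized one. *)
Lemma upot_le (x : R) : `|x| <= pi ->
  (upot m x <= (green_height x)%:E * upot m' 0)%E.
Proof.
have pi0 := pi_gt0 R.
(* At the endpoints [green_height x] is 0 and cannot be divided by, but there the kernel itself
   vanishes. *)
rewrite le_eqVlt => /predU1P[xpi|xpi].
  have -> : green_height x = 0.
    by rewrite /green_height -real_normK ?num_real// xpi divff ?subrr// sqrf_eq0 gt_eqF.
  rewrite mul0e /upot integral0_eq// => y; rewrite IclE ler_norml => /andP[y1 y2].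
  have [x0|x0] := leP 0 x.
    move: xpi; rewrite ger0_norm// => xpi.
    by rewrite green_le ?xpi// subrr !mul0r.
  move: xpi; rewrite ltr0_norm// => xpi.
  rewrite green_ge; last by lra.
  have -> : pi + x = 0 by lra.
  by rewrite !mul0r.
have k0 : 0 < green_height x.
  rewrite green_heightE; move: xpi; rewrite ltr_norml => /andP[? ?].
  by rewrite divr_gt0 ?exprn_gt0// mulr_gt0//; lra.
have -> : upot m x = ((green_height x)%:E *
    \int[m]_(y in @Icl R) (green x y / green_height x)%:E)%E.
  rewrite -ge0_integralZl//.
  - apply: eq_integral => y _; rewrite -EFinM; congr EFin.
    by rewrite mulrCA divff ?mulr1// gt_eqF.
  - apply/measurable_EFinP; apply: measurable_funM => //.
    by apply: measurable_funTS; exact: measurable_green.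
  - move=> y; rewrite IclE => yp; rewrite lee_fin divr_ge0 ?(ltW k0)//.
    by rewrite green_ge0// ltW.
  - by rewrite lee_fin ltW.
rewrite lee_pmul2l ?lte_fin//.
have mh : measurable_fun (@Icl R) (fun y => (green x y / green_height x)%:E).
  apply/measurable_EFinP; apply: measurable_funM => //.
  by apply: measurable_funTS; exact: measurable_green.
rewrite (finite_layer_cake m_fin mIcl mh); last first.
  move=> y; rewrite IclE => yp; rewrite lee_fin divr_ge0 ?(ltW k0)//.
  by rewrite green_ge0// ltW.
rewrite /upot (finite_layer_cake m'_fin mIcl (@mgreen _ 0)); last first.
  by move=> y; rewrite IclE => yp; rewrite lee_fin green_ge0// normr0 ltW.
apply: ge0_le_integral => //.
- exact: finite_measurable_distribution.
- exact: finite_measurable_distribution.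
move=> s; rewrite /= in_itv/= andbT => s0.
rewrite green0_superlevel//.
set E := (X in m X).
have mE : measurable E by apply: emeasurable_fun_o_infty.
pose c := 2 * s / pi.
have cE : c * pi = 2 * s by rewrite /c divfK// gt_eqF.
have c0 : 0 <= c by rewrite divr_ge0 ?mulr_ge0// ltW.
have subE y : E y -> [/\ s < pi / 2, - pi + c * (pi + x) < y & y < pi - c * (pi - x)].
  move=> [_ /=]; rewrite lte_fin ltr_pdivlMr// mulrC.
  exact: green_superlevel.
(* At levels from pi / 2 on, the superlevel set is empty; below, the radius [pi - 2 * s] is
   positive, as [dominated] demands. *)
have [spi|spi] := ltP s (pi / 2); last first.
  rewrite (_ : E = set0) ?measure0//; apply/seteqP; split => // y /subE[].
  by rewrite ltNge spi.
move: xpi; rewrite ltr_norml => /andP[x1 x2].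
have cx1 : 0 <= c * (pi + x) by rewrite mulr_ge0//; lra.
have cx2 : 0 <= c * (pi - x) by rewrite mulr_ge0//; lra.
apply: dominated => //.
- by move=> y /subE[_ y1 y2]; rewrite /Iop /= in_itv/=; lra.
- by lra.
have : (lambda E <= lambda `](- pi + c * (pi + x))%R, (pi - c * (pi - x))%R[%classic)%E.
  apply: le_measure; rewrite ?inE// => y /subE[_ y1 y2].
  by rewrite /= in_itv/= y1.
move/le_trans; apply; rewrite lebesgue_measure_itv/= lte_fin.
case: ifPn => _; rewrite -?EFinD lee_fin; lra.
Qed.

Lemma upot_eq_dense : (upot m' 0 <= upot m 0)%E ->
  forall a b : R, 0 <= a -> a < b -> b <= pi ->
  exists2 r, a < r < b & m' `](- r)%R, r[%classic = m `](- r)%R, r[%classic.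
Proof.
move=> le0 a b a0 ab bpi.
have pi0 := pi_gt0 R.
have g0 y : @Icl R y -> (0 <= (green 0 y)%:E)%E.
  by rewrite IclE => yp; rewrite lee_fin green_ge0// normr0 ltW.
have LC (n : {measure set R -> \bar R}) : (n setT < +oo)%E -> upot n 0 =
    (\int[lambda]_(s in `[(0 : R)%R, +oo[)
      n (@Icl R `&` [set y | s%:E < (green 0 y)%:E]))%E.
  by move=> nfin; rewrite /upot (finite_layer_cake nfin).
(* Level [s] corresponds to radius [pi - 2 * s], which maps this range of levels to the radii
   between [a] and [b]; its lower end is nonnegative because [b <= pi]. *)
have [s /andP[as' sb] mm'] : exists2 s, (pi - b) / 2 < s < (pi - a) / 2 &
    m' (@Icl R `&` [set y | (s%:E < (green 0 y)%:E)%E]) =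
    m (@Icl R `&` [set y | (s%:E < (green 0 y)%:E)%E]).
  apply: eq_in_itv_of_integral_le.
  - exact: finite_measurable_distribution.
  - exact: finite_measurable_distribution.
  - by move=> s _; exact: measure_ge0.
  - move=> s s0; rewrite green0_superlevel//.
    have [ss|ss] := ltP 0 (pi - 2 * s); last first.
      rewrite (_ : [set` _] = set0) ?measure0//.
      by apply/seteqP; split => // y; rewrite /= in_itv/= => /andP[]; lra.
    apply: dominated => //.
    + by apply: sub_itv_Iop; lra.
    + by lra.
    + by rewrite lebesgue_measure_sym_itv// ltW.
  - move=> s _; apply: le_lt_trans m'_fin; apply: le_measure; rewrite ?inE//.
    exact: emeasurable_fun_o_infty.
  - by rewrite -!LC.
  - by rewrite -LC// upotE// ltry.
  - lra.
  - lra.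
move: mm'; have s0 : 0 <= s by lra.
rewrite green0_superlevel// => mm'.
by exists (pi - 2 * s) => //; lra.
Qed.

End comparison.
End potential.

(** * The symmetrization of a measure *)

(** Arbitrarily short centred intervals carry the full mass, so the punctured interval is a
    countable union of null sets. What remains is concentrated at 0. *)
Lemma measure_eq_dirac (R : realType) (nu : {measure set R -> \bar R}) :
  nu (~` @Iop R) = 0%E -> (nu (@Iop R) < +oo)%E ->
  (forall b : R, 0 < b -> b <= pi ->
    exists2 r, 0 < r < b & nu `](- r)%R, r[%classic = nu (@Iop R)) ->
  forall A, measurable A -> nu A = (nu (@Iop R) * \d_(0%R : R) A)%E.
Proof.
move=> nu_out nu_fin centered.
have mI := @measurable_Iop R.
have mI0 := @measurable_Iop0 R.
have pi0 := pi_gt0 R.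
have nuI0 : nu (@Iop R `\ 0) = 0%E.
  apply/negligibleP => //.
  pose F n : set R := @Iop R `\` `](- (pi / n.+1%:R)), (pi / n.+1%:R)[%classic.
  apply: (@negligibleS _ _ _ nu (\bigcup_n F n)).
    move=> t; rewrite Iop0E => /andP[t0 tpi].
    have [n _ /(_ _ (leqnn _))/=] := near_infty_natSinv_lt (PosNum (divr_gt0 t0 pi0)).
    rewrite ltr_pdivlMr// mulrC => nt; exists n => //; split; first by rewrite IopE.
    by rewrite /= in_itv/= -ltr_norml; apply/negP; rewrite -leNgt ltW.
  apply: negligible_bigcup => n.
  have bn0 : 0 < pi / n.+1%:R :> R by rewrite divr_gt0.
  have bnpi : pi / n.+1%:R <= pi :> R by rewrite ler_pdivrMr// ler_peMr ?ler1n// ltW.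
  have [r /andP[r0 rb] nur] := centered _ bn0 bnpi.
  have rpi : r <= pi by rewrite (le_trans (ltW rb)).
  exists (@Iop R `\` `](- r)%R, r[%classic); split.
  - exact: measurableD.
  - have -> : nu (@Iop R `\` `](- r)%R, r[%classic) =
        (nu (@Iop R) - nu (@Iop R `&` `](- r)%R, r[%classic))%E.
      by apply: measureD.
    rewrite setIidr ?nur; last exact: sub_itv_Iop.
    by rewrite subee// ge0_fin_numE ?measure_ge0.
  - move=> t [tI /= H]; split => // H'; apply: H; move: H'.
    by rewrite /= !in_itv/= -!ltr_norml => /lt_trans; exact.
have nu0 (A : set R) : measurable A -> ~ A 0 -> nu A = 0%E.
  move=> mA A0; apply: (@subset_measure0 _ _ _ nu _ ((@Iop R `\ 0) `|` ~` @Iop R)) => //.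
  - by apply: measurableU => //; exact: measurableC.
  - move=> t At; have [tI|tI] := pselect (@Iop R t); [left|by right].
    by split => // t0; apply: A0; rewrite -t0.
  - apply/negligibleP; first by apply: measurableU => //; exact: measurableC.
    by apply: negligibleU; apply/negligibleP => //; exact: measurableC.
have nu1 (A : set R) : measurable A -> A 0 -> nu A = nu [set 0].
  move=> mA A0; have <- : A `&` [set 0] = [set 0] by apply/seteqP; split => t => [[]|->].
  rewrite [LHS](@measureDI _ _ _ nu _ [set 0])// -[RHS]add0e; congr (_ + _)%E.
  by apply: nu0 => [|[_ /(_ erefl)]//]; exact: measurableD.
have I0 : @Iop R 0 by rewrite IopE normr0.
move=> A mA; rewrite diracE; case: (boolP (0 \in A)); rewrite ?inE => A0.
  by rewrite mule1 !nu1.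
by rewrite mule0 nu0// => A0'; move/negP: A0; rewrite inE.
Qed.

Lemma adde_le_eq (R : realDomainType) (a b c d : \bar R) :
  a \is a fin_num -> b \is a fin_num -> c \is a fin_num -> d \is a fin_num ->
  (a <= c)%E -> (b <= d)%E -> (c + d = a + b)%E -> c = a /\ d = b.
Proof.
case: a b c d => [a| |] // [b| |] // [c| |] // [d| |] // _ _ _ _.
rewrite !lee_fin -!EFinD => ac bd [] cdab.
by split; congr EFin; lra.
Qed.

(** * Comparison with the symmetrized measure, [nu] being the sum of the singular and discrete
    parts *)

Section symmetrization.
Variables (R : realType) (mu nu musharp : {measure set R -> \bar R}) (f : R -> R).
Local Notation lambda := (@lebesgue_measure R).
Hypotheses (mu_out : mu (~` @Iop R) = 0%E) (mu_gt0 : (0 < mu setT)%E)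
  (mu_fin : (mu setT < +oo)%E).
Hypotheses (mf : measurable_fun setT f) (f0 : forall x, 0 <= f x).
Hypothesis f_int : (\int[lambda]_(x in @Icl R) (f x)%:E < +oo)%E.
Hypothesis muE : forall A, measurable A ->
  mu A = (\int[lambda]_(x in A `&` @Iop R) (f x)%:E + nu A)%E.
Hypothesis musharpE : forall A, measurable A -> musharp A =
  (\int[lambda]_(x in A `&` @Iop R) fsharp f x + nu (@Iop R) * \d_(0%R : R) A)%E.

Let mI := @measurable_Iop R.
Let pi0 : 0 < pi :> R. Proof. exact: pi_gt0. Qed.

Let mfE D : measurable_fun D (fun x => (f x)%:E).
Proof. by apply/measurable_EFinP; exact: measurable_funTS. Qed.

Let intf_ge0 A : (0 <= \int[lambda]_(x in A) (f x)%:E)%E.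
Proof. by apply: integral_ge0 => x _; rewrite lee_fin. Qed.

Let intfs_ge0 A : A `<=` @Iop R -> (0 <= \int[lambda]_(x in A) fsharp f x)%E.
Proof. by move=> AI; apply: integral_ge0 => x /AI; rewrite IopE; exact: fsharp_ge0. Qed.

Let nu_le_mu A : measurable A -> (nu A <= mu A)%E.
Proof. by move=> mA; rewrite muE// leeDr. Qed.

Let nu_out : nu (~` @Iop R) = 0%E.
Proof.
by apply/eqP; rewrite -measure_le0 -mu_out; apply: nu_le_mu; exact: measurableC.
Qed.

Let nu_fin : (nu (@Iop R) < +oo)%E.
Proof.
apply: le_lt_trans (nu_le_mu mI) _; apply: le_lt_trans mu_fin.
by apply: le_measure; rewrite ?inE.
Qed.

Lemma symmetrization_fin : (musharp setT < +oo)%E.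
Proof.
rewrite musharpE// setTI integral_fsharp_Iop// lte_add_pinfty//.
by rewrite diracT mule1.
Qed.

Let dirac_sym_itv (r : R) : 0 < r -> \d_(0%R : R) `](- r)%R, r[%classic = 1%E :> \bar R.
Proof. by move=> r0; rewrite diracE mem_set//= in_itv/= oppr_lt0 r0. Qed.

Let musharp_sym_itv (r : R) : 0 < r <= pi -> musharp `](- r)%R, r[%classic =
  (\int[lambda]_(x in `](- r)%R, r[) fsharp f x + nu (@Iop R))%E.
Proof.
move=> /andP[r0 rpi]; rewrite musharpE// dirac_sym_itv// mule1.
by rewrite setIidl//; exact: sub_itv_Iop.
Qed.

Let f_dominated (E : set R) (r : R) : measurable E -> E `<=` @Iop R ->
  0 < r <= pi -> (lambda E <= (2 * r)%:E)%E ->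
  (\int[lambda]_(x in E) (f x)%:E <= \int[lambda]_(x in `](- r)%R, r[) fsharp f x)%E.
Proof.
move=> mE EI /andP[r0 rpi] Er; apply: integral_le_fsharp => //.
- by move=> t _; rewrite lee_fin.
- by move=> s _; exact: measure_superlevel_le_distr.
- by rewrite ltW.
Qed.

(** The density part is the rearrangement inequality. The mass of [nu] on [E] is at most its total
    mass, which [musharp] places at 0, a point of ]-r, r[ since [r] is positive. *)
Lemma le_symmetrization (E : set R) (r : R) : measurable E -> E `<=` @Iop R ->
  0 < r <= pi -> (lambda E <= (2 * r)%:E)%E -> (mu E <= musharp `](- r)%R, r[%classic)%E.
Proof.
move=> mE EI r0pi Er; rewrite musharp_sym_itv// muE// leeD//.
  by rewrite setIidl//; exact: f_dominated.
by apply: le_measure; rewrite ?inE.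
Qed.

Lemma symmetrization_le_symmetrization (E : set R) (r : R) :
  measurable E -> E `<=` @Iop R -> 0 < r <= pi -> (lambda E <= (2 * r)%:E)%E ->
  (musharp E <= musharp `](- r)%R, r[%classic)%E.
Proof.
move=> mE EI /[dup] r0pi /andP[r0 rpi] Er; rewrite musharp_sym_itv// musharpE// leeD//.
  rewrite setIidl//; apply: integral_le_fsharp => //.
  - exact: measurable_fsharp.
  - by move=> t; exact: fsharp_ge0.
  - by move=> s _; exact: measure_fsharp_superlevel_le_distr.
  - by rewrite ltW.
by rewrite -[leRHS]mule1 lee_wpmul2l// diracE lee_fin lern1 leq_b1.
Qed.

Lemma upot_le_symmetrization (x : R) : `|x| <= pi ->
  (upot mu x <= (green_height x)%:E * upot musharp 0)%E.
Proof.
apply: upot_le => //; [exact: symmetrization_fin|exact: le_symmetrization].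
Qed.

Let green_height_le1 (x : R) : green_height x <= 1.
Proof. by rewrite /green_height gerBl divr_ge0 ?sqr_ge0. Qed.

Lemma upot_symmetrization_max (x : R) : `|x| <= pi -> (upot musharp x <= upot musharp 0)%E.
Proof.
move=> xpi; apply: le_trans (upot_le symmetrization_fin symmetrization_fin _ xpi) _.
  exact: symmetrization_le_symmetrization.
by rewrite gee_pMl ?upot_ge0 ?normr0 ?pi_ge0 ?lee_fin// upotE// symmetrization_fin.
Qed.

Lemma upot_mu_le (x : R) : `|x| <= pi -> (upot mu x <= upot musharp 0)%E.
Proof.
move=> xpi; apply: le_trans (upot_le_symmetrization xpi) _.
by rewrite gee_pMl ?upot_ge0 ?normr0 ?pi_ge0 ?lee_fin// upotE// symmetrization_fin.
Qed.

(** The kernel [green 0] is strictly positive on the open interval and [mu] is non-zero, so already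
    [upot mu 0] is positive. This permits the cancellation in [upot_eq_center]. *)
Lemma upot_symmetrization_gt0 : (0 < upot musharp 0)%E.
Proof.
have p0 : `|0 : R| <= pi by rewrite normr0 ltW.
apply: lt_le_trans (upot_mu_le p0); rewrite lt0e upot_ge0// andbT.
apply/eqP => u0.
have muI : mu (@Iop R) = 0%E.
  have mIcl : measurable (@Icl R) by exact: measurable_itv.
  have mg : measurable_fun (@Icl R) (fun y => (green 0 y)%:E).
    by apply/measurable_EFinP; apply: measurable_funTS; exact: measurable_green.
  have : (\int[mu]_(y in @Icl R) `|(green 0 y)%:E| = 0)%E.
    rewrite -u0; apply: eq_integral => y; rewrite inE IclE => yp.
    by rewrite gee0_abs// lee_fin green_ge0.
  move/(ae_eq_integral_abs mu mIcl mg) => [N [mN N0 subN]].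
  apply: (@subset_measure0 _ _ _ mu _ N) => // y; rewrite IopE => yp.
  apply: subN => /= /(_ _) H; have : @Icl R y by rewrite IclE ltW.
  by move/H => []; rewrite green0E; lra.
move: mu_gt0; have -> : mu setT = 0%E; last by rewrite ltxx.
rewrite -(setUv (@Iop R)); apply/negligibleP.
  by apply: measurableU => //; exact: measurableC.
by apply: negligibleU; apply/negligibleP => //; exact: measurableC.
Qed.

(** Cancelling the positive finite number [upot musharp 0] in [upot_le_symmetrization] leaves
    [1 <= green_height x], which forces [x ^+ 2 <= 0]. *)
Lemma upot_eq_center (x : R) : `|x| <= pi -> upot mu x = upot musharp 0 -> x = 0.
Proof.
move=> xpi ux; have := upot_le_symmetrization xpi; rewrite ux.
have := upot_symmetrization_gt0; rewrite upotE ?symmetrization_fin// -EFinM lte_fin lee_fin.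
move=> U0; rewrite -[leLHS]mul1r ler_pM2r// /green_height lerBrDr gerDl.
rewrite pmulr_lle0 ?invr_gt0 ?exprn_gt0// => x0.
by apply/eqP; rewrite -sqrf_eq0 eq_le x0 sqr_ge0.
Qed.

Lemma eq_symmetrization : upot mu 0 = upot musharp 0 ->
  forall A, measurable A -> mu A = musharp A.
Proof.
move=> u0.
have musharp_fin := symmetrization_fin.
(* On these intervals [musharp] and [mu] have equal mass. Since the density and the singular part
   are each dominated separately and everything is finite, the equality splits into two. *)
have dense (a b : R) : 0 <= a -> a < b -> b <= pi -> exists2 r, a < r < b &
    (\int[lambda]_(x in `](- r)%R, r[) fsharp f x =
     \int[lambda]_(x in `](- r)%R, r[) (f x)%:E)%E /\
    nu (@Iop R) = nu `](- r)%R, r[%classic.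
  move=> a0 ab bpi.
  have u0' : (upot musharp 0 <= upot mu 0)%E by rewrite u0.
  have [r /andP[ar rb] mm'] :=
    upot_eq_dense mu_fin musharp_fin le_symmetrization u0' a0 ab bpi.
  exists r; first by rewrite ar.
  have r0 : 0 < r by exact: le_lt_trans ar.
  have rpi : r <= pi by exact: le_trans (ltW rb) bpi.
  have rI := @sub_itv_Iop R r rpi.
  have fin_fs : (\int[lambda]_(x in `](- r)%R, r[) fsharp f x)%E \is a fin_num.
    rewrite ge0_fin_numE ?intfs_ge0//; apply: le_lt_trans f_int.
    rewrite -integral_fsharp_Iop//; apply: ge0_subset_integral => //.
    - exact: measurable_fsharp.
    - by move=> t; rewrite IopE; exact: fsharp_ge0.
  have le_f : (\int[lambda]_(x in `](- r)%R, r[) (f x)%:E <=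
      \int[lambda]_(x in `](- r)%R, r[) fsharp f x)%E.
    by apply: f_dominated; rewrite ?r0 ?rpi ?lebesgue_measure_sym_itv// ltW.
  have fin_nuI : nu (@Iop R) \is a fin_num by rewrite ge0_fin_numE.
  have le_nu : (nu `](- r)%R, r[%classic <= nu (@Iop R))%E.
    by apply: le_measure; rewrite ?inE.
  apply: adde_le_eq => //.
  - by rewrite ge0_fin_numE// (le_lt_trans le_f)// -ge0_fin_numE ?intfs_ge0.
  - by rewrite ge0_fin_numE// (le_lt_trans le_nu).
  - move: mm'; rewrite musharp_sym_itv ?r0// muE// => ->.
    by rewrite setIidl.
move=> A mA; rewrite muE// musharpE//; congr (_ + _)%E.
  apply: integral_fsharp_eq => // a b a0 ab bpi.
  by have [r rab [e _]] := dense a b a0 ab bpi; exists r => //; rewrite e.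
apply: measure_eq_dirac => // b b0 bpi.
by have [r rab [_ e]] := dense 0 b (lexx _) b0 bpi; exists r => //; rewrite -e.
Qed.

End symmetrization.

Theorem theorem3p11 (R : realType)
  (mu : {measure set R -> \bar R})
  (f : R -> R) (sigma delta : {measure set R -> \bar R})
  (musharp : {measure set R -> \bar R}) :
  (* mu is a positive, non-zero, finite Borel measure on (-pi, pi) *)
  mu (~` (@Iop R)) = 0%E ->
  (0 < mu setT < +oo)%E ->
  (* Lebesgue decomposition mu = f dlambda + sigma + delta *)
  measurable_fun setT f ->
  (forall x, 0 <= f x) ->
  (\int[lebesgue_measure]_(x in (@Icl R)) (f x)%:E < +oo)%E ->
  singular_leb sigma -> atomless sigma ->
  purely_discontinuous delta ->
  (forall A, measurable A ->
     mu A = (\int[lebesgue_measure]_(x in A `&` (@Iop R)) (f x)%:E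
             + sigma A + delta A)%E) ->
  (* musharp is the symmetrization f^# dlambda + M d_0, M = sigma + delta total mass *)
  (forall A, measurable A ->
     musharp A = (\int[lebesgue_measure]_(x in A `&` (@Iop R)) fsharp f x
                  + (sigma (@Iop R) + delta (@Iop R)) * \d_(0%R : R) A)%E) ->
  [/\ upot musharp 0%R = ereal_sup (upot musharp @` (@Icl R)),
      exists2 x0, x0 \in (@Icl R) & upot mu x0 = ereal_sup (upot mu @` (@Icl R)),
      (ereal_sup (upot mu @` (@Icl R)) <= upot musharp 0%R)%E &
      (ereal_sup (upot mu @` (@Icl R)) = upot musharp 0%R <->
         forall A, measurable A -> mu A = musharp A)].
Proof.
move=> mu_out /andP[mu_gt0 mu_fin] mf f0 f_int _ _ _ muE musharpE.
(* Both parts are moved to 0 by the symmetrization, so they are treated as a single measure. *)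
pose nu := measure_add sigma delta.
have {}muE A : measurable A ->
    mu A = (\int[lebesgue_measure]_(x in A `&` @Iop R) (f x)%:E + nu A)%E.
  by move=> mA; rewrite muE// -addeA /nu measure_addE.
have {}musharpE A : measurable A -> musharp A =
    (\int[lebesgue_measure]_(x in A `&` @Iop R) fsharp f x
     + nu (@Iop R) * \d_(0%R : R) A)%E.
  by move=> mA; rewrite musharpE// /nu measure_addE.
have Icl0 : @Icl R 0 by rewrite IclE normr0 pi_ge0.
have max0 : upot musharp 0 = ereal_sup (upot musharp @` @Icl R).
  apply/eqP; rewrite eq_le; apply/andP; split.
    by apply: ereal_sup_ubound; exists 0.
  apply: ge_ereal_sup => _ [x + <-]; rewrite IclE.
  exact: (upot_symmetrization_max mu_fin mf f0 f_int muE musharpE).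
split => //.
- exact: upot_attains_sup.
- apply: ge_ereal_sup => _ [x + <-]; rewrite IclE.
  exact: (upot_mu_le mu_fin mf f0 f_int muE musharpE).
- split => [eq_sup|eq_mu].
    (* A maximum point of the potential of [mu] exists, and equality of the maxima puts it at 0. *)
    have [x0] := upot_attains_sup mu_fin; rewrite inE IclE eq_sup => x0pi ux0.
    have x00 := upot_eq_center mu_out mu_gt0 mu_fin mf f0 f_int muE musharpE x0pi ux0.
    move: ux0; rewrite x00.
    exact: (eq_symmetrization mu_out mu_fin mf f0 f_int muE musharpE).
  rewrite max0; congr ereal_sup; apply: eq_imagel => x _.
  by apply: eq_measure_integral => A mA _; exact: eq_mu.
Qed.
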